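(* Let $a$ be a real number and $n$ a positive integer. Then, as identities in the variables $x,y$: (i) $\frac a2\big(E_{n,a}(x+1)+E_{n,a}(x-1)\big)+(1-a)E_{n,a}(x)=x^n$; (ii) $\sum_{k=0}^n\binom nk E_{n-k,a}(x)\Big\{\frac a2\big((y+1)^k+(y-1)^k\big)+(1-a)y^k\Big\}=(x+y)^n$; (iii) $E_{n,a}(x)=x^n-a\sum_{k=1}^{\lfloor n/2\rfloor}\binom n{2k}E_{n-2k,a}(x)$.
   Context: For a real number $a$, the sequence $\{E_{n,a}\}$ is defined by $E_{0,a}=1$ and $E_{n,a}=-a\sum_{k=1}^{\lfloor n/2\rfloor}\binom{n}{2k}E_{n-2k,a}$ for $n\ge 1$, and the polynomials $E_{n,a}(x)$ are defined by $E_{n,a}(x)=\sum_{k=0}^n\binom nk E_{k,a}x^{n-k}$ for $n\ge 0$. *)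

(* Defs.v *)
From mathcomp Require Import all_boot all_order all_algebra.
From mathcomp Require Import reals.

Set Implicit Arguments.
Unset Strict Implicit.
Unset Printing Implicit Defensive.

Import Order.TTheory GRing.Theory Num.Theory.
Local Open Scope ring_scope.

(* [:: E_{0,a}; ...; E_{n,a}]: the course-of-values recursion appends the next
   term to the list of all the previous ones; [Eseq_rec] below recovers the
   recurrence. *)
Fixpoint Eprefix (R : realType) (a : R) (n : nat) : seq R :=
  if n isn't m.+1 then [:: 1] else
  let s := Eprefix a m in
  rcons s (- a * \sum_(1 <= k < (m.+1)./2.+1)
                   'C(m.+1, 2 * k)%:R * s`_(m.+1 - 2 * k)).

Definition Eseq (R : realType) (a : R) (n : nat) : R := (Eprefix a n)`_n.

Definition Epoly (R : realType) (a : R) (n : nat) : {poly R} :=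
  \sum_(0 <= k < n.+1) ('C(n, k)%:R * Eseq a k) *: 'X^(n - k).

Lemma size_Eprefix (R : realType) (a : R) n : size (Eprefix a n) = n.+1.
Proof. by elim: n => //= n IHn; rewrite size_rcons IHn. Qed.

Lemma nth_Eprefix (R : realType) (a : R) n i :
  (i <= n)%N -> (Eprefix a n)`_i = Eseq a i.
Proof.
elim: n => [|n IHn]; first by rewrite leqn0 => /eqP ->.
rewrite leq_eqVlt => /predU1P[-> //|]; rewrite ltnS => le_in.
by rewrite /= nth_rcons size_Eprefix ltnS le_in IHn.
Qed.

Lemma Eseq0 (R : realType) (a : R) : Eseq a 0 = 1.
Proof. by []. Qed.

Lemma Eseq_rec (R : realType) (a : R) n : (0 < n)%N ->
  Eseq a n =
  - a * \sum_(1 <= k < n./2.+1) 'C(n, 2 * k)%:R * Eseq a (n - 2 * k).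
Proof.
case: n => // n _; rewrite {1}/Eseq [Eprefix _ _]/=.
rewrite nth_rcons size_Eprefix ltnn eqxx; congr (_ * _).
apply: eq_big_nat => k /andP[k_gt0 _]; rewrite nth_Eprefix //.
by case: k k_gt0 => // k _; rewrite mulnS subSS leq_subr.
Qed.

(* Main.v *)
Require Import Defs.
From mathcomp Require Import all_boot all_order all_algebra.
From mathcomp Require Import reals.
From mathcomp Require Import ring.

Import Order.TTheory GRing.Theory Num.Theory.
Local Open Scope ring_scope.

(* The polynomials E_n = E_{n,a} form an Appell sequence:
   E_n(x+y) = sum_k C(n,k) E_{n-k}(x) y^k.  Put
   T p (x) = a/2 (p(x+1) + p(x-1)) + (1-a) p(x).  The addition formula turns
   the left-hand side of (ii) into (T E_n)(x+y), so (ii) reduces to (i), and it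
   also shows that T E_n is an Appell sequence.  The defining recurrence says
   that (T E_m)(0) = [m = 0], hence (T E_n)(x) = x^n, which is (i).  Finally,
   (iii) is (ii) at y = 0. *)

(** Both sides are n! / (i! j! (n-i-j)!) when i + j <= n, and 0 otherwise. *)
Lemma mul_bin_trinomial (n i j : nat) :
  ('C(n, i + j) * 'C(i + j, i) = 'C(n, i) * 'C(n - i, j))%N.
Proof.
have [le_ijn|lt_nij] := leqP (i + j) n; last first.
  rewrite bin_small // mul0n; have [le_in|lt_ni] := leqP i n.
    by rewrite [X in (_ * X)%N]bin_small ?muln0 // ltn_subLR.
  by rewrite bin_small.
have le_in : (i <= n)%N by apply: leq_trans le_ijn; exact: leq_addr.
have le_jni : (j <= n - i)%N by rewrite leq_subRL.
have f_gt0 : (0 < i`! * j`! * (n - (i + j))`!)%N by rewrite !muln_gt0 !fact_gt0.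
apply/eqP; rewrite -(eqn_pmul2r f_gt0); apply/eqP.
transitivity n`!.
  rewrite -(bin_fact le_ijn) -(bin_fact (leq_addr j i)) addKn.
  by rewrite !mulnA.
rewrite -(bin_fact le_in) -(bin_fact le_jni) subnDA.
by rewrite -!mulnA; congr muln; rewrite mulnCA.
Qed.

Lemma coef_Epoly (R : realType) (a : R) (n j : nat) :
  (Epoly a n)`_j = 'C(n, j)%:R * Eseq a (n - j).
Proof.
rewrite /Epoly coef_sum big_mkord.
under eq_bigr => i _ do rewrite coefZ coefXn.
have [le_jn|lt_nj] := leqP j n; last first.
  rewrite bin_small // mul0r big1 // => i _.
  by rewrite gtn_eqF ?mulr0 // (leq_ltn_trans (leq_subr _ _)).
(* Only the index n - j contributes the monomial of degree j. *)
rewrite (bigD1 (inord (n - j))) //= inordK ?ltnS ?leq_subr //.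
rewrite subKn // eqxx mulr1 bin_sub // big1 ?addr0 // => i neq_i.
case: eqP => [eq_j|_]; last by rewrite mulr0.
case/eqP: neq_i; apply/val_inj; rewrite /= inordK ?ltnS ?leq_subr //.
by rewrite eq_j subKn // -ltnS.
Qed.

Lemma size_Epoly (R : realType) (a : R) (n : nat) : (size (Epoly a n) <= n.+1)%N.
Proof.
by apply/leq_sizeP => j lt_nj; rewrite coef_Epoly bin_small ?mul0r.
Qed.

(** The Appell property, for derivatives divided by k!: on coefficients it is [mul_bin_trinomial].
    Taylor expansion then gives the addition formula. *)
Lemma nderivn_Epoly (R : realType) (a : R) (n k : nat) :
  (Epoly a n)^`N(k) = 'C(n, k)%:R *: Epoly a (n - k).
Proof.
apply/polyP => j; rewrite coef_nderivn coefZ !coef_Epoly subnDA.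
by rewrite -mulrnAl -mulrnA mulrA -natrM mul_bin_trinomial.
Qed.

Lemma Epoly_add (R : realType) (a : R) (n : nat) (x y : R) :
  (Epoly a n).[x + y] =
  \sum_(0 <= k < n.+1) 'C(n, k)%:R * (Epoly a (n - k)).[x] * y ^+ k.
Proof.
rewrite (nderiv_taylor_wide _ (size_Epoly _ a n)) ?big_mkord; last exact: mulrC.
by apply: eq_bigr => k _; rewrite nderivn_Epoly hornerZ.
Qed.

Lemma Epoly_at0 (R : realType) (a : R) (n : nat) : (Epoly a n).[0] = Eseq a n.
Proof. by rewrite horner_coef0 coef_Epoly bin0 mul1r subn0. Qed.

(** The operator T, taken on functions so that it applies to evaluations of polynomials and to
    powers of y alike. *)
Definition shift_mean {R : realType} (a : R) (f : R -> R) (x : R) : R :=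
  a / 2 * (f (x + 1) + f (x - 1)) + (1 - a) * f x.

Lemma shift_mean_sum (R : realType) (a : R) (n : nat) (c : nat -> R)
    (f : nat -> R -> R) (x : R) :
  shift_mean a (fun t => \sum_(0 <= k < n) c k * f k t) x =
  \sum_(0 <= k < n) c k * shift_mean a (f k) x.
Proof.
rewrite /shift_mean -big_split /= !mulr_sumr -big_split /=.
by apply: eq_bigr => k _; ring.
Qed.

(** T is linear and commutes with translations, so it can act in y on the addition formula while x
    stays fixed. *)
Lemma shift_mean_Epoly_add (R : realType) (a : R) (n : nat) (x y : R) :
  \sum_(0 <= k < n.+1)
     'C(n, k)%:R * (Epoly a (n - k)).[x] * shift_mean a (fun t => t ^+ k) y =
  shift_mean a (horner (Epoly a n)) (x + y).
Proof.
rewrite -(shift_mean_sum R a _ _ (fun k t => t ^+ k)) /shift_mean.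
by rewrite -!Epoly_add !addrA.
Qed.

(** Here the roles are exchanged: T acts at 0 on the polynomial factor, and the powers of y are
    constants. *)
Lemma shift_mean_Epoly_appell (R : realType) (a : R) (n : nat) (y : R) :
  shift_mean a (horner (Epoly a n)) y =
  \sum_(0 <= k < n.+1)
     'C(n, k)%:R * y ^+ k * shift_mean a (horner (Epoly a (n - k))) 0.
Proof.
rewrite -(shift_mean_sum R a _ _ (fun k => horner (Epoly a (n - k)))).
have E t : (Epoly a n).[y + t] =
    \sum_(0 <= k < n.+1) 'C(n, k)%:R * y ^+ k * (Epoly a (n - k)).[t].
  by rewrite addrC Epoly_add; apply: eq_bigr => k _; rewrite mulrAC.
by rewrite /shift_mean -!E !add0r addr0.
Qed.

Lemma shift_mean_pow0 (R : realType) (a : R) (k : nat) :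
  shift_mean a (fun t => t ^+ k) 0 =
  if k == 0%N then 1 else if odd k then 0 else a.
Proof.
rewrite /shift_mean !add0r expr1n expr0n -signr_odd.
(* Since 0^0 = 1, the term 1 - a survives only for k = 0, where the value is a + (1 - a). *)
case: k => [|k]; first by rewrite /= expr0; field.
by case: (odd _); rewrite /= ?expr1 ?expr0; field.
Qed.

Lemma sum_even_nat (R : realType) (n : nat) (F : nat -> R) :
  \sum_(0 <= k < n.+1) (if odd k then 0 else F k) =
  \sum_(0 <= k < n./2.+1) F (2 * k)%N.
Proof.
elim: n => [|n IHn]; first by rewrite !big_nat1.
rewrite big_nat_recr //= IHn uphalf_half.
case: (boolP (odd n)) => odd_n /=; last by rewrite addr0.
rewrite add1n [RHS]big_nat_recr //=; congr (_ + F _).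
by rewrite -{1}(odd_double_half n) odd_n add1n mul2n doubleS.
Qed.

(** Odd k drop out by parity. [F] is kept general to cover both E_m(0), needed for (i), and E_m(x),
    needed for (iii). *)
Lemma sum_shift_mean_pow0 (R : realType) (a : R) (n : nat) (F : nat -> R) :
  \sum_(0 <= k < n.+1)
     'C(n, k)%:R * F (n - k)%N * shift_mean a (fun t => t ^+ k) 0 =
  F n + a * \sum_(1 <= k < n./2.+1) 'C(n, 2 * k)%:R * F (n - 2 * k)%N.
Proof.
pose G k := 'C(n, k)%:R * F (n - k)%N * (if k == 0%N then 1 else a).
transitivity (\sum_(0 <= k < n.+1) (if odd k then 0 else G k)).
  apply: eq_bigr => k _; rewrite shift_mean_pow0 /G.
  by case: k => //= k; case: (odd k); rewrite ?mulr0.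
rewrite sum_even_nat big_ltn // /G muln0 eqxx bin0 subn0 mul1r mulr1.
congr (_ + _); rewrite mulr_sumr; apply: eq_big_nat => k /andP[k_gt0 _].
by rewrite muln_eq0 /= eqn0Ngt k_gt0 mulrC.
Qed.

Lemma shift_mean_Epoly0 (R : realType) (a : R) (n : nat) :
  shift_mean a (horner (Epoly a n)) 0 = (n == 0%N)%:R.
Proof.
rewrite -[0 in LHS]addr0 -shift_mean_Epoly_add.
rewrite (sum_shift_mean_pow0 R a n (fun m => (Epoly a m).[0])) Epoly_at0.
under eq_bigr => k _ do rewrite Epoly_at0.
(* For n = 0 the sum is empty and E_0 = 1 remains; for n > 0 the recurrence cancels everything. *)
case: n => [|n]; first by rewrite big_geq // mulr0 addr0.
by rewrite Eseq_rec // mulNr addNr.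
Qed.

Lemma shift_mean_Epoly (R : realType) (a : R) (n : nat) (x : R) :
  shift_mean a (horner (Epoly a n)) x = x ^+ n.
Proof.
rewrite shift_mean_Epoly_appell big_nat_recr //= subnn shift_mean_Epoly0.
rewrite binn mul1r mulr1 big_nat big1 ?add0r // => k /andP[_ lt_kn].
by rewrite shift_mean_Epoly0 subn_eq0 leqNgt lt_kn mulr0.
Qed.

Theorem theorem2p2 (R : realType) (a : R) (n : nat) (n_gt0 : (0 < n)%N) :
  [/\ forall x : R,
        a / 2 * ((Epoly a n).[x + 1] + (Epoly a n).[x - 1])
          + (1 - a) * (Epoly a n).[x] = x ^+ n,
      forall x y : R,
        \sum_(0 <= k < n.+1) 'C(n, k)%:R * (Epoly a (n - k)).[x] *
          (a / 2 * ((y + 1) ^+ k + (y - 1) ^+ k) + (1 - a) * y ^+ k)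
        = (x + y) ^+ n
    & forall x : R,
        (Epoly a n).[x] =
        x ^+ n - a * \sum_(1 <= k < n./2.+1)
                       'C(n, 2 * k)%:R * (Epoly a (n - 2 * k)).[x]].
Proof.
split=> [x|x y|x]; first exact: shift_mean_Epoly.
  by rewrite -(shift_mean_Epoly R a n (x + y)) -shift_mean_Epoly_add.
(* Reading x as x + 0 turns x^n into the sum of (ii) at y = 0, whose k = 0 term is E_n(x). *)
rewrite -[in x ^+ n](addr0 x) -(shift_mean_Epoly R a) -shift_mean_Epoly_add.
by rewrite (sum_shift_mean_pow0 R a n (fun m => (Epoly a m).[x])) addrK.
Qed.
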